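(* Let $\ell\ge1$ be an integer, let $p\ge5$ be prime and let $b$ be an integer with $0\le b<p$ satisfying $\left(\dfrac{24b+1}{p}\right)=-1$. Then for every integer $n\ge0$, \[ \overline{p}_{3\ell}(24pn+24b+1)\equiv0\pmod4. \]
   Context: $\left(\frac{\cdot}{p}\right)$ is the Legendre symbol. For $k\ge1$ let $f_k=\prod_{m\ge1}(1-q^{km})$. For an integer $\ell\ge1$, $\overline{p}_\ell(n)$ denotes the number of 2-color overpartitions of $n$ (the first occurrence of a part of each color may be overlined) in which one of the two colors appears only in parts that are multiples of $\ell$; its generating function is $\sum_{n\ge0}\overline{p}_\ell(n)q^n=\dfrac{f_2f_{2\ell}}{f_1^2f_\ell^2}$. *)

(* Defs.v *)
From mathcomp Require Import all_boot all_order all_algebra.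

Set Implicit Arguments.
Unset Strict Implicit.
Unset Printing Implicit Defensive.

(* The Legendre symbol (a / p), for p an odd prime. *)
Definition legendre (a : int) (p : nat) : int :=
  if (p %| a)%Z then 0%R
  else if [exists x : 'I_p, (x%:Z ^+ 2 == a %[mod p])%Z] then 1%R
  else (-1)%R.

(* Color and size. In a partition of n every size and every multiplicity is at
   most n, so bounding both by n below excludes nothing. *)
Definition colored_part (n : nat) : finType := (bool * 'I_n.+1)%type.

Definition part_color n (x : colored_part n) : bool := x.1.
Definition part_size n (x : colored_part n) : nat := x.2.

(* A 2-color overpartition: the multiplicity of each colored part, and the set
   of colored parts whose first occurrence is overlined. *)
Definition overpartition2_data (n : nat) : finType :=
  ({ffun colored_part n -> 'I_n.+1} * {set colored_part n})%type.

(* The color restricted to multiples of l is [true]. *)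
Definition is_overpartition2 (l n : nat) (P : overpartition2_data n) : bool :=
  let: (m, overlined) := P in
  [&& [forall x, (0 < m x) ==> (0 < part_size x)],
      [forall x, (0 < m x) && part_color x ==> (l %| part_size x)],
      \sum_x m x * part_size x == n
    & overlined \subset [set x | 0 < m x]].

Definition pbar (l n : nat) : nat := #|[set P | @is_overpartition2 l n P]|.

(* Main.v *)
(** An overpartition amounts to a 2-colored partition together with a subset
    of its support, so [pbar L n] is the sum of [2 ^ r] over the admissible
    colored partitions of [n], where [r] is the number of distinct colored
    parts. For [n > 0] only those with [r = 1] survive modulo 4. When [L] does
    not divide [n], these are the partitions [n = d + ... + d] in the
    unrestricted color, one for each divisor [d] of [n], and the number of
    divisors is even unless [n] is a square. Here [n] is prime to 3 and is a
    quadratic non-residue modulo [p]. *)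

Require Import Defs.
From mathcomp Require Import all_boot all_order all_algebra.
From mathcomp Require Import zify.

(** The involution sending [d] to [n %/ d] exchanges the divisors with [d * d < n] and the remaining
    ones; as [n] is not a square, it has no fixed point. *)
Lemma even_card_divisors (n : nat) :
  0 < n -> (forall d, d * d <> n) -> ~~ odd #|[set d : 'I_n.+1 | d %| n]|.
Proof.
move=> n0 nsq; set D := [set _ | _].
set A := [set d : 'I_n.+1 | d * d < n].
pose co (d : 'I_n.+1) : 'I_n.+1 := inord (n %/ d).
have coE d : co d = n %/ d :> nat by rewrite inordK // ltnS leq_div.
have coM d : d \in D -> co d * d = n by rewrite inE coE => /divnK.
have coD d : d \in D -> co d \in D.
  by move=> dD; rewrite inE -[X in _ %| X](coM d dD) dvdn_mulr.
have coK d : d \in D -> co (co d) = d.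
  move=> dD; apply/val_inj; have h1 := coM _ dD; have h2 := coM _ (coD _ dD).
  have c0 : 0 < co d by case: (posnP (co d)) h1 => // ->; lia.
  by apply/eqP; rewrite -(eqn_pmul2r c0) h2 mulnC h1.
have coA d : d \in D -> (co d \in A) = (d \notin A).
  (* From [co d * d = n], the square of [co d] is below [n] iff [co d < d], iff [d * d] exceeds [n];
     equality is excluded by [nsq]. *)
  move=> dD; have h := coM _ dD; have := nsq d; rewrite !inE => h2.
  by apply/idP/idP; nia.
suff e : co @: (D :&: A) = D :\: A.
  rewrite -(cardsID A D) -e card_in_imset ?addnn ?odd_double //.
  move=> x y /setIP[xD _] /setIP[yD _] exy.
  by rewrite -(coK x xD) exy coK.
apply/setP => y; apply/imsetP/setDP => [[x /setIP[xD xA] ->]|[yD yA]].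
  by split; [exact: coD | rewrite -coA ?coK ?coD].
by exists (co y); rewrite ?coK // inE coD // coA.
Qed.

Definition is_colored_partition (L n : nat)
    (m : {ffun colored_part n -> 'I_n.+1}) : bool :=
  [&& [forall x, (0 < m x) ==> (0 < part_size x)],
      [forall x, (0 < m x) && part_color x ==> (L %| part_size x)]
    & \sum_x m x * part_size x == n].

Definition support_size (n : nat) (m : {ffun colored_part n -> 'I_n.+1}) : nat :=
  #|[set x | 0 < m x]|.

Lemma pbarE (L n : nat) :
  pbar L n = \sum_(m | is_colored_partition L n m) 2 ^ support_size n m.
Proof.
rewrite /pbar -sum1_card.
under [RHS]eq_bigr => m _ do rewrite -card_powerset -sum1_card.
rewrite pair_big_dep; apply: eq_bigl => -[m o].
by rewrite !inE /is_colored_partition /= -!andbA.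
Qed.

Lemma support_size_gt0 (L n : nat) m :
  0 < n -> is_colored_partition L n m -> 0 < support_size n m.
Proof.
move=> n0 /and3P[_ _ /eqP sm]; rewrite card_gt0; apply/eqP => m0.
suff : n = 0 by lia.
rewrite -sm big1 // => x _; have := in_set0 x; rewrite -m0 inE.
by case: (val (m x)) => // *.
Qed.

Lemma card_support_size1 (L n : nat) :
  0 < n -> ~~ (L %| n) ->
  #|[set m | is_colored_partition L n m & support_size n m == 1]|
    = #|[set d : 'I_n.+1 | d %| n]|.
Proof.
move=> n0 Ln; set D := [set d : 'I_n.+1 | _].
(* [n %/ d] copies of the part [d] in the unrestricted color. *)
pose F (d : 'I_n.+1) : {ffun colored_part n -> 'I_n.+1} :=
  [ffun x => if x == (false, d) then inord (n %/ d) else ord0].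
have FE d x : F d x = (if x == (false, d) then n %/ d else 0) :> nat.
  by rewrite ffunE; case: ifP => // _; rewrite inordK // ltnS leq_div.
have Dpos d : d \in D -> (0 < d) && (0 < n %/ d).
  rewrite inE => dn; have d0 := dvdn_gt0 n0 dn.
  by rewrite d0 divn_gt0 // dvdn_leq.
have Fsupp d : d \in D -> [set x | 0 < F d x] = [set (false, d)].
  move=> /Dpos/andP[_ q0]; apply/setP => x; rewrite !inE FE.
  by case: eqP => // _; rewrite q0.
(* [F] is injective on divisors because the support of [F d] determines [d]. *)
rewrite -(card_in_imset (f := F) (D := D)); last first.
  move=> d e dD eD /(congr1 (fun m : {ffun _ -> 'I_n.+1} => [set x | 0 < m x])).
  by rewrite !Fsupp // => /set1_inj[].
apply/eq_card => m; rewrite inE; apply/idP/imsetP => [|[d dD ->]].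
  case/andP=> /and3P[_ /forallP mcol /eqP msum] /cards1P[[c d] supp].
  have m0 x : x != (c, d) -> m x = 0 :> nat.
    move=> nx; have : x \notin [set x | 0 < m x] by rewrite supp inE.
    by rewrite inE -eqn0Ngt => /eqP.
  have mx : 0 < m (c, d).
    by have := set11 (c, d); rewrite -supp inE.
  have md : m (c, d) * d = n.
    rewrite -[RHS]msum (bigD1 (c, d)) //= big1 ?addn0 // => x /m0 ->.
    by rewrite mul0n.
  have dn : d %| n by apply/dvdnP; exists (m (c, d)).
  (* In the restricted color, [L] would divide [d] and hence [n]. *)
  have cF : c = false.
    case: c {supp m0 md} mx => // mx; have := mcol (true, d).
    by rewrite mx /= => Ld; rewrite (dvdn_trans Ld dn) in Ln.
  subst c; exists d; first by rewrite inE.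
  apply/ffunP => x; apply/val_inj; rewrite /= FE.
  case: eqP => [->|/eqP/m0 //].
  by apply/eqP; rewrite eqn_div ?md ?(dvdn_gt0 n0 dn).
have /andP[d0 q0] := Dpos d dD.
apply/andP; split; last by rewrite /support_size Fsupp // cards1.
apply/and3P; split.
- by apply/forallP => x; rewrite FE; case: eqP => [->|]; rewrite //= d0 implybT.
- by apply/forallP => x; rewrite FE; case: eqP => [->|]; rewrite //= andbF.
- rewrite (bigD1 (false, d)) //= FE eqxx big1 ?addn0.
    by rewrite divnK //; rewrite inE in dD.
  by move=> x /negPf nx; rewrite FE nx.
Qed.

Lemma pbar_mod4 (L n : nat) :
  0 < n -> ~~ (L %| n) -> (forall d, d * d <> n) -> pbar L n = 0 %[mod 4].
Proof.
move=> n0 Ln nsq; apply/eqP; rewrite mod0n -/(dvdn 4 _) pbarE.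
(* Outside support size 1 the size is at least 2, since [n > 0] excludes 0, so 4 divides each power
   of 2. *)
rewrite (bigID (fun m => support_size n m == 1)) /= dvdn_add //; last first.
  apply: dvdn_sum => m /andP[/(support_size_gt0 _ _ _ n0) s0 s1].
  by rewrite (dvdn_exp2l 2 (_ : 2 <= _)) //; lia.
rewrite (eq_bigr (fun=> 2)) => [|m /andP[_ /eqP->] //].
rewrite sum_nat_const.
rewrite (_ : #|_| = #|[set d : 'I_n.+1 | d %| n]|); last first.
  by rewrite -(card_support_size1 L) //; apply: eq_card => m; rewrite !inE.
by rewrite -[4]/(2 * 2) dvdn_pmul2r // dvdn2 even_card_divisors.
Qed.

Lemma legendreN1_nonsquare (a p : nat) :
  0 < p -> legendre (Posz a) p = (-1)%R -> forall d, d * d <> a %[mod p].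
Proof.
move=> p0; rewrite /legendre; case: ifP => // _.
case: ifP => // /negbT/negP nex _ d da.
(* [legendre] searches only residues below [p], so [d] is reduced modulo [p]. *)
apply: nex; apply/existsP; exists (Ordinal (ltn_pmod d p0)).
by rewrite GRing.expr2 -PoszM !modz_nat modnMm da.
Qed.

Theorem theorem3p3 (l p b : nat)
    (hl : 1 <= l) (hp : prime p) (hp5 : 5 <= p) (hb : b < p)
    (hleg : legendre (Posz (24 * b + 1)) p = (-1)%R) :
  forall n : nat, pbar (3 * l) (24 * p * n + 24 * b + 1) = 0 %[mod 4].
Proof.
move=> n; apply: pbar_mod4; first by rewrite addn1.
  (* Divisibility by [3 * l] would give divisibility by 3, but the argument is 1 modulo 3. *)
  apply/negP => /(dvdn_trans (dvdn_mulr l (dvdnn 3))).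
  by rewrite -!mulnA; lia.
(* The argument is congruent to [24 * b + 1] modulo [p]. *)
move=> d dn; apply: (legendreN1_nonsquare _ _ (prime_gt0 hp) hleg d).
by rewrite dn -addnA [24 * p]mulnC -mulnA mulnC modnMDl.
Qed.
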